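(* Let $G$ be a simple weighted graph on $n$ vertices and let $1\le m\le n$. Then $\lambda_m(G)\ge d_m(G)-\Delta(G_{l_m})$.
   Context: A weighted graph $G$ is a simple graph with a positive weight $w_{ij}$ on each edge $\{i,j\}$. Its adjacency matrix $A(G)$ has entries $a_{ij}=w_{ij}$ if $\{i,j\}$ is an edge and $0$ otherwise; the degree of vertex $v_i$ is $d_i(G)=\sum_j a_{ij}$, and $D(G)$ is the diagonal matrix of degrees. The Laplacian is $L(G)=D(G)-A(G)$, with eigenvalues $0=\lambda_1(G)\le\dots\le\lambda_n(G)$. The vertices are labeled $v_1,\dots,v_n$ so that $d_1(G)\le d_2(G)\le\dots\le d_n(G)$. Let $l_m=\{v_m,v_{m+1},\dots,v_n\}$ (the $n-m+1$ vertices of largest degree) and let $G_{l_m}$ be the weighted subgraph of $G$ induced by $l_m$. For a weighted graph $H$, $\Delta(H)$ denotes the largest (weighted) degree of a vertex of $H$. *)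

(* Defs.v *)
From HB Require Import structures.
From mathcomp Require Import all_boot all_order all_algebra.
From mathcomp Require Import polyrcf.

Set Implicit Arguments.
Unset Strict Implicit.
Unset Printing Implicit Defensive.

Import Order.TTheory GRing.Theory Num.Theory.

Local Open Scope ring_scope.

(* [weight G] is meaningful on edges only: its other values are
   unconstrained, and no definition below depends on them. *)
Record wgraph (R : numDomainType) (V : finType) := WGraph {
  edge : rel V;
  weight : V -> V -> R;
  edge_sym : symmetric edge;
  edge_irr : irreflexive edge;
  weight_sym : forall u v, edge u v -> weight u v = weight v u;
  weight_gt0 : forall u v, edge u v -> 0 < weight u v
}.

Section WeightedGraph.

Variables (R : realDomainType) (V : finType) (G : wgraph R V).

Definition adj (u v : V) : R := if edge G u v then weight G u v else 0.

Definition wdeg (v : V) : R := \sum_(u : V) adj v u.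

(* Weighted degrees are nonnegative, so starting the maximum at 0 does not
   change its value when V is nonempty. *)
Definition maxdeg : R := \big[Num.max/0]_(v : V) wdeg v.

Variable S : {set V}.

Let subV : finType := {v : V | v \in S}.
Let sedge : rel subV := fun u v => edge G (val u) (val v).
Let sweight (u v : subV) : R := weight G (val u) (val v).

Fact induced_edge_sym : symmetric sedge.
Proof. by move=> u v; apply: edge_sym. Qed.

Fact induced_edge_irr : irreflexive sedge.
Proof. by move=> u; apply: edge_irr. Qed.

Fact induced_weight_sym u v : sedge u v -> sweight u v = sweight v u.
Proof. exact: weight_sym. Qed.

Fact induced_weight_gt0 u v : sedge u v -> 0 < sweight u v.
Proof. exact: weight_gt0. Qed.

Definition induced : wgraph R {v : V | v \in S} :=
  WGraph induced_edge_sym induced_edge_irr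
         induced_weight_sym induced_weight_gt0.

End WeightedGraph.

Section Laplacian.

Variables (R : realDomainType) (n : nat) (G : wgraph R 'I_n).

Definition adjmx : 'M[R]_n := \matrix_(i, j) adj G i j.

Definition degmx : 'M[R]_n := diag_mx (\row_i wdeg G i).

Definition lapmx : 'M[R]_n := degmx - adjmx.

End Laplacian.

(* The eigenvalues of A lying in R, in nondecreasing order and repeated
   according to algebraic multiplicity ([rootsR] lists the distinct roots in
   increasing order).  A symmetric A of order n has exactly n of them. *)
Definition eigenvalues (R : rcfType) (n : nat) (A : 'M[R]_n) : seq R :=
  flatten [seq nseq (mup x (char_poly A)) x | x <- rootsR (char_poly A)].

Lemma eigenvaluesE (R : rcfType) (n : nat) (A : 'M[R]_n) (s : seq R) :
  sorted <=%R s -> char_poly A = \prod_(x <- s) ('X - x%:P) ->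
  eigenvalues A = s.
Proof.
move=> s_sorted pA; have p_neq0 := monic_neq0 (char_poly_monic A).
have rootE x : (x \in rootsR (char_poly A)) = (x \in s).
  have := roots_on_rootsR p_neq0 x; rewrite inE /= => <-.
  by rewrite pA root_prod_XsubC.
have r_sorted : sorted <%R (rootsR (char_poly A)) by apply: sorted_roots.
have muE x : mup x (char_poly A) = count_mem x s by rewrite pA mu_prod_XsubC.
rewrite /eigenvalues; set r := rootsR _ in rootE r_sorted *.
apply: (le_sorted_eq _ s_sorted).
  elim: r r_sorted {rootE} => //= y r IHr yr.
  have ry : all (> y) r by move: yr; rewrite lt_path_sortedE => /andP[].
  have {}IHr := IHr (path_sorted yr).
  elim: (mup _ _) => //= k IHk; rewrite le_path_sortedE IHk andbT.
  rewrite all_cat; apply/andP; split; first by rewrite all_nseq lexx orbT.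
  apply/allP => z /flatten_mapP[t /(allP ry) /= yt].
  by rewrite mem_nseq => /andP[_ /eqP->]; apply: ltW.
apply/allP => x _ /=; apply/eqP; rewrite count_flatten -map_comp.
rewrite (eq_map (g := fun y => if y == x then count_mem x s else 0%N)); last first.
  move=> y /=; rewrite count_nseq /= muE.
  by case: eqP => [->|_]; rewrite ?mul1n ?mul0n.
have r_uniq : uniq r by apply: lt_sorted_uniq.
rewrite sumnE big_map -big_mkcond big_const_seq iter_addn_0.
rewrite (count_uniq_mem _ r_uniq) rootE.
case: (boolP (x \in s)) => [_|/count_memPn ->]; by rewrite ?muln1 ?muln0.
Qed.

(* Indices start at 0: [eigenval A 0] is the smallest eigenvalue. *)
Definition eigenval (R : rcfType) (n : nat) (A : 'M[R]_n) (k : nat) : R :=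
  nth 0 (eigenvalues A) k.

(* Main.v *)
(* Half of the Courant-Fischer principle: a symmetric form that is at least c on
   the vectors vanishing on v_1, ..., v_{m-1} has its m-th eigenvalue at least c.
   On those vectors the Laplacian form is sum d_i |x_i|^2 minus the adjacency
   form of G_{l_m}, and the latter is at most Delta(G_{l_m}) |x|^2 by
   2 Re (x_i conj(x_j)) <= |x_i|^2 + |x_j|^2.  The spectral theorem is available
   over algebraically closed fields, hence the passage to R[i]. *)
Require Import Defs.
From mathcomp Require Import all_boot all_order all_algebra.
From mathcomp Require Import complex ring.

Set Implicit Arguments.
Unset Strict Implicit.
Unset Printing Implicit Defensive.

Import Order.TTheory GRing.Theory Num.Theory.

Local Open Scope ring_scope.
Local Open Scope sesquilinear_scope.

Lemma char_poly_conj (F : fieldType) (n : nat) (P A : 'M[F]_n) :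
  P \in unitmx -> char_poly (invmx P *m A *m P) = char_poly A.
Proof.
move=> Pu; rewrite /char_poly.
have VP : map_mx polyC (invmx P) *m map_mx polyC P = 1%:M.
  by rewrite -map_mxM mulVmx // map_mx1.
have -> : char_poly_mx (invmx P *m A *m P)
        = map_mx polyC (invmx P) *m char_poly_mx A *m map_mx polyC P.
  rewrite /char_poly_mx !map_mxM mulmxBr mulmxBl; congr (_ - _).
  by rewrite scalar_mxC -mulmxA VP mulmx1.
by rewrite !det_mulmx mulrAC -det_mulmx VP det1 mul1r.
Qed.

Section RealSymmetric.

Variables (R : rcfType) (n : nat) (A : 'M[R]_n).
Hypothesis A_sym : A^T = A.

Local Notation toC := (real_complex R).
Local Notation AC := (map_mx toC A).

Lemma complex_hermsym : AC \is hermsymmx.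
Proof.
apply: realsym_hermsym.
  apply/is_hermitianmxP.
  by rewrite expr0 scale1r map_mx_id // map_trmx A_sym.
by apply/mxOverP => i j; rewrite mxE; apply/complex_realP; exists (A i j).
Qed.

(** Taking real parts loses nothing, since a Hermitian matrix has real spectrum. The entries are not
    sorted. *)
Definition spectrum : 'rV[R]_n := map_mx (@complex.Re R) (spectral_diag AC).

Lemma spectrumE : map_mx toC spectrum = spectral_diag AC.
Proof.
apply/rowP => i; rewrite !mxE RRe_real //.
exact: (mxOverP (hermitian_spectral_diag_real complex_hermsym)).
Qed.

Lemma complex_spectral :
  AC = invmx (spectralmx AC) *m diag_mx (map_mx toC spectrum) *m spectralmx AC.
Proof.
by rewrite spectrumE; apply/orthomx_spectralP/hermitian_normalmx/complex_hermsym.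
Qed.

Lemma char_poly_spectrum :
  char_poly A = \prod_(i < n) ('X - (spectrum 0 i)%:P).
Proof.
(* The factorization is checked over [R[i]], where the matrix is similar to a diagonal one. *)
apply: (map_poly_inj toC); rewrite map_char_poly complex_spectral.
rewrite char_poly_conj ?spectral_unit // char_poly_trig ?diag_mx_is_trig //.
rewrite rmorph_prod; apply: eq_bigr => i _.
by rewrite rmorphB /= map_polyX map_polyC !mxE eqxx.
Qed.

Lemma eigenvalues_spectrum :
  eigenvalues A = sort <=%R [seq spectrum 0 i | i : 'I_n].
Proof.
apply: eigenvaluesE; first exact: sort_le_sorted.
rewrite char_poly_spectrum (perm_big _ (permEl (perm_sort _ _))) /=.
by rewrite big_map big_enum.
Qed.

(* If more than m eigenvalues were below c, some nonzero combination of their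
   eigenvectors would have its first m coordinates equal to 0. *)
Lemma eigenval_ge (c : R) (m : 'I_n) :
  (forall x : 'rV[R[i]]_n, (forall i : 'I_n, (i < m)%N -> x 0 i = 0) ->
    toC c * (x *m x^t*) 0 0 <= (x *m AC *m x^t*) 0 0) ->
  c <= eigenval A m.
Proof.
move=> A_ge; rewrite /eigenval eigenvalues_spectrum.
(* With indices from 0, entry [m] of a sorted list is at least [c] once at most [m] entries lie
   below [c]. *)
apply: nth_count_ge; first exact: sort_le_sorted.
rewrite count_sort size_sort size_map size_enum_ord ltn_ord andbT.
set K := [pred i : 'I_n | spectrum 0 i < c].
rewrite count_map (_ : count _ _ = #|K|); last first.
  by rewrite -sum1_count big_enum_cond sum1_card.
rewrite leqNgt; apply/negP => mK.
set P := spectralmx AC.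
(* The rows of [E *m P] are the eigenvectors with eigenvalue below [c], and [W] keeps their first
   [m] coordinates. Having more than [m] rows, [W] has a nonzero left kernel. *)
pose E : 'M[R[i]]_(#|K|, n) := rowsub enum_val 1%:M.
pose W : 'M[R[i]]_(#|K|, m) := colsub (widen_ord (ltnW (ltn_ord m))) (E *m P).
have /rowV0Pn[y /sub_kermxP yW y_neq0] : kermx W != 0.
  rewrite kermx_eq0 -row_leq_rank -ltnNge.
  by apply: leq_ltn_trans (rank_leq_col W) mK.
(* [z] holds the coordinates of the test vector [z *m P] in the eigenbasis; it is supported on
   [K]. *)
pose z := y *m E.
have zK i : i \notin K -> z 0 i = 0.
  move=> iK; rewrite mxE big1 // => k _; rewrite !mxE.
  case: eqP => [ki|_]; last by rewrite mulr0.
  by rewrite -ki enum_valP in iK.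
have [i0 zi0] : exists i, z 0 i != 0.
  have [k yk] := rV0Pn _ y_neq0; exists (enum_val k).
  rewrite mxE (bigD1 k) //= !mxE eqxx mulr1 big1 ?addr0 // => l lk.
  by rewrite !mxE (inj_eq enum_val_inj) (negPf lk) mulr0.
have zP (i : 'I_n) : (i < m)%N -> (z *m P) 0 i = 0.
  move=> im; have /rowP/(_ (Ordinal im)) := yW.
  rewrite mulmx_colsub mulmxA mxE [RHS]mxE => <-.
  by congr (_ 0 _); apply: val_inj.
have Pu : P \is unitarymx by apply: spectral_unitarymx.
(* As [P] is unitary, both forms at [z *m P] become diagonal in [z]. The hypothesis then says that
   the sum of the [(c - spectrum 0 i) * |z i|^2] is at most 0, but its terms are nonnegative and the
   one at [i0] is positive. *)
have := A_ge _ zP; rewrite complex_spectral -/P invmx_unitary //.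
rewrite trmx_mul map_mxM !mulmxA !mulmxtVK // -mulmxA mul_diag_mx !mxE.
rewrite mulr_sumr -subr_le0 -sumrB => /le_gtF/negbT/negP; apply.
have F_ge0 i : toC (c - spectrum 0 i) * `|z 0 i| ^+ 2 >= 0.
  have [iK|/zK ->] := boolP (i \in K); last by rewrite normr0 expr0n mulr0.
  by rewrite mulr_ge0 ?exprn_ge0 // ler0c subr_ge0 ltW.
rewrite (eq_bigr (fun i => toC (c - spectrum 0 i) * `|z 0 i| ^+ 2)); last first.
  by move=> i _; rewrite normCK rmorphB mulrBl ![_ * (z 0 i * _)]mulrCA !mxE.
rewrite (bigD1 i0) //= ltr_pwDl ?sumr_ge0 // mulr_gt0 ?exprn_gt0 ?normr_gt0 //.
by rewrite ltcR subr_gt0; apply: contraR zi0 => iK; apply/eqP/zK.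
Qed.

End RealSymmetric.

(* Twice the difference of the two sides is the sum of the w i j * |x i - x j| ^ 2. *)
Lemma sum_weight_conj_le (C : numClosedFieldType) (I : finType) (S : {set I})
    (w : I -> I -> C) (x : I -> C) :
  (forall i j, 0 <= w i j) -> (forall i j, w i j = w j i) ->
  \sum_(i in S) \sum_(j in S) w i j * (x i * (x j)^*)
    <= \sum_(i in S) \sum_(j in S) w i j * `|x i| ^+ 2.
Proof.
move=> w_ge0 w_sym; set L := (X in X <= _); set U := (X in _ <= X).
(* Using the index-swapped form for one of two copies of each sum supplies the conjugate cross terms
   and the [|x j|^2] needed to complete the square. *)
have L_sym : L = \sum_(i in S) \sum_(j in S) w i j * (x j * (x i)^*).
  by rewrite /L exchange_big; under eq_bigr do under eq_bigr do rewrite w_sym.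
have U_sym : U = \sum_(i in S) \sum_(j in S) w i j * `|x j| ^+ 2.
  by rewrite /U exchange_big; under eq_bigr do under eq_bigr do rewrite w_sym.
have dirichlet : U + U - (L + L)
    = \sum_(i in S) \sum_(j in S) w i j * `|x i - x j| ^+ 2.
  rewrite {2}U_sym {2}L_sym -!big_split -sumrB; apply: eq_bigr => i _ /=.
  rewrite -!big_split -sumrB; apply: eq_bigr => j _ /=.
  by rewrite !normCK rmorphB; ring.
have : 0 <= U + U - (L + L).
  rewrite dirichlet; apply: sumr_ge0 => i _; apply: sumr_ge0 => j _.
  by rewrite mulr_ge0 ?exprn_ge0.
by rewrite subr_ge0 -!mulr2n lerMn2r.
Qed.

Section Graph.

Variables (R : realDomainType) (V : finType) (G : wgraph R V).

Lemma adj_ge0 u v : 0 <= adj G u v.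
Proof. by rewrite /adj; case: ifP => // /weight_gt0/ltW. Qed.

Lemma adj_sym u v : adj G u v = adj G v u.
Proof. by rewrite /adj edge_sym; case: ifP => // /weight_sym. Qed.

(** Reindexed by the subtype of [S], the sum is the degree of [u] in the induced graph. *)
Lemma le_maxdeg_induced (S : {set V}) u :
  u \in S -> \sum_(v in S) adj G u v <= maxdeg (induced G S).
Proof.
move=> uS; rewrite big_sub.
exact: (le_bigmax _ (wdeg (induced G S)) (Sub u uS)).
Qed.

End Graph.

Lemma lapmx_sym (R : realDomainType) (n : nat) (G : wgraph R 'I_n) :
  (lapmx G)^T = lapmx G.
Proof.
rewrite /lapmx linearB /= tr_diag_mx; congr (_ - _).
by apply/matrixP => i j; rewrite !mxE adj_sym.
Qed.

Theorem theorem3 (R : rcfType) (n : nat) (G : wgraph R 'I_n)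
    (deg_sorted : forall i j : 'I_n, (i <= j)%N -> wdeg G i <= wdeg G j)
    (m : 'I_n) :
  wdeg G m - maxdeg (induced G [set i : 'I_n | (m <= i)%N])
    <= eigenval (lapmx G) m.
Proof.
apply: eigenval_ge => [|x x_eq0]; first exact: lapmx_sym.
(* Ordinals start at 0, so [S] is l_m and the test vectors [x] are those supported on it. *)
set S := [set i : 'I_n | (m <= i)%N]; pose toC := real_complex R.
have x0 i : i \notin S -> x 0 i = 0 by rewrite inE -ltnNge => /x_eq0.
have -> : (x *m x^t*) 0 0 = \sum_(i in S) `|x 0 i| ^+ 2.
  rewrite mxE (bigID (mem S)) /= [X in _ + X]big1 => [|i /x0 ->].
    by rewrite addr0; apply: eq_bigr => i _; rewrite normCK !mxE.
  by rewrite mul0r.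
have -> : (x *m map_mx toC (lapmx G) *m x^t*) 0 0
    = \sum_(i in S) toC (wdeg G i) * `|x 0 i| ^+ 2
    - \sum_(i in S) \sum_(j in S) toC (adj G i j) * (x 0 i * (x 0 j)^*).
  rewrite /lapmx map_mxB mulmxBr mulmxBl mxE [X in _ + X]mxE; congr (_ - _).
    rewrite map_diag_mx mul_mx_diag mxE (bigID (mem S)) /=.
    rewrite [X in _ + X]big1 => [|i /x0 xi]; last by rewrite !mxE xi !mul0r.
    by rewrite addr0; apply: eq_bigr => i _; rewrite normCK !mxE mulrCA mulrA.
  rewrite mxE; under eq_bigr do rewrite mxE mulr_suml.
  rewrite exchange_big (bigID (mem S)) /= [X in _ + X]big1 => [|i /x0 xi].
    rewrite addr0; apply: eq_bigr => i _.
    rewrite (bigID (mem S)) /= [X in _ + X]big1 => [|j /x0 xj].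
      by rewrite addr0; apply: eq_bigr => j _; rewrite !mxE mulrCA mulrA.
    by rewrite !mxE xj conjC0 mulr0.
  by apply: big1 => j _; rewrite xi !mul0r.
(* The two parts are compared separately: sorted degrees give d_i at least d_m on [S], and the
   adjacency form is bounded through the row sums over [S]. *)
rewrite rmorphB mulrBl lerB //.
  rewrite mulr_sumr; apply: ler_sum => i; rewrite inE => mi.
  by rewrite ler_wpM2r ?exprn_ge0 // lecR deg_sorted.
have toC_adj_ge0 i j : 0 <= toC (adj G i j) by rewrite ler0c adj_ge0.
have toC_adj_sym i j : toC (adj G i j) = toC (adj G j i) by rewrite adj_sym.
apply: le_trans (sum_weight_conj_le S (x 0) toC_adj_ge0 toC_adj_sym) _.
rewrite mulr_sumr; apply: ler_sum => i iS.
by rewrite -mulr_suml ler_wpM2r ?exprn_ge0 // -rmorph_sum lecR le_maxdeg_induced.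
Qed.
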